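(* Let $\mathcal M=(\mathcal S,\mathcal A,r,P,\rho)$ be a finite MDP with a parametrized policy class $\{\pi_\theta\}_{\theta\in\Theta}$ such that, for every policy in the class, the induced Markov chain on $\mathcal S$ has a single recurrent class. Then for every $\theta\in\Theta$ and every integer $t\ge1$, $$\Big\|\frac1t\sum_{i=1}^t(P^{\pi_\theta})^i(s_0,\cdot)-d^{\pi_\theta}(\cdot)\Big\|_{\mathrm{TV}}\le\frac Ct\qquad\text{for all }s_0\in\mathcal S,$$ where $C=C_{\mathrm{hit}}+C_{\mathrm{tar}}$.
   Context: $\mathcal S$ and $\mathcal A$ are finite; $P^{\pi_\theta}(s,s')=\sum_aP(s'|s,a)\pi_\theta(a|s)$ is the transition matrix of the chain induced by $\pi_\theta$ and $d^{\pi_\theta}$ its unique stationary distribution (transient states and periodicity are allowed). $\|\cdot\|_{\mathrm{TV}}=\frac12\|\cdot\|_1$. $\mathcal S_R^\theta$ is the recurrent class under $\pi_\theta$; $T_\theta=\inf\{t\ge0:s_t\in\mathcal S_R^\theta\}$; $C_{\mathrm{hit}}^\theta=\max_{s\in\mathcal S}\mathbb E_s^\theta[T_\theta]$; for $s'\in\mathcal S$, $T_{s'}=\inf\{t\ge0:s_t=s'\}$; $C_{\mathrm{tar}}^\theta=\sum_{s'\in\mathcal S}d^{\pi_\theta}(s')\mathbb E_s^\theta[T_{s'}]$ for a fixed $s\in\mathcal S_R^\theta$ (independent of the choice of such $s$). $\mathbb E_s^\theta$ is expectation for the chain under $\pi_\theta$ started at $s$. $C_{\mathrm{hit}}=\sup_\theta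 C_{\mathrm{hit}}^\theta$, $C_{\mathrm{tar}}=\sup_\theta C_{\mathrm{tar}}^\theta$. *)

(* Defs.v *)
From HB Require Import structures.
From mathcomp Require Import all_boot all_order all_algebra.
From mathcomp Require Import all_classical all_reals all_analysis.

Set Implicit Arguments.
Unset Strict Implicit.
Unset Printing Implicit Defensive.

Import Order.TTheory GRing.Theory Num.Theory.

Local Open Scope classical_set_scope.
Local Open Scope ring_scope.

Definition is_dist (R : realType) (I : finType) (p : I -> R) : Prop :=
  (forall i, 0 <= p i) /\ \sum_(i : I) p i = 1.

(* [trans M s a s'] is P(s' | s, a). *)
Record mdp (R : realType) (S A : finType) := MDP {
  trans : S -> A -> S -> R;
  reward : S -> A -> R;
  init : S -> R;
  trans_dist : forall s a, is_dist (trans s a);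
  init_dist : is_dist init }.

Record policy (R : realType) (S A : finType) := Policy {
  pol :> S -> A -> R;
  pol_dist : forall s, is_dist (pol s) }.

Section Chain.
Variables (R : realType) (S : finType).

Definition induced_kernel (A : finType) (M : mdp R S A) (p : policy R S A) :
    S -> S -> R :=
  fun s s' => \sum_(a : A) trans M s a s' * p s a.

Definition kernel_mx (P : S -> S -> R) : 'M[R]_#|S| :=
  \matrix_(i, j) P (enum_val i) (enum_val j).

Definition kernel_pow (P : S -> S -> R) (n : nat) : S -> S -> R :=
  fun s s' => (kernel_mx P ^+ n) (enum_rank s) (enum_rank s').

Definition stationary (P : S -> S -> R) (d : S -> R) : Prop :=
  is_dist d /\ forall s', \sum_(s : S) d s * P s s' = d s'.

Definition tv (f g : S -> R) : R := 2^-1 * \sum_(s : S) `|f s - g s|.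

Section Trajectories.
Variables (disp : measure_display) (Omega : measurableType disp).
Variable X : nat -> Omega -> S.

(* Under [Pr], X is a Markov chain with transition kernel P started at s: the
   conditional law of X_(n+1) given (X_0, ..., X_n) is P(X_n, .), the
   conditional probability being multiplied out so that conditioning paths of
   probability 0 need no special treatment. S carries the discrete
   sigma-algebra, hence the form of the measurability clause. *)
Definition markov_chain (P : S -> S -> R) (s : S) (Pr : probability Omega R) :
    Prop :=
  [/\ forall n x, measurable (X n @^-1` [set x]),
      Pr (X 0%N @^-1` [set s]) = 1%E &
      forall (n : nat) (x : nat -> S),
        Pr [set w | forall i, (i <= n.+1)%N -> X i w = x i] =
        (Pr [set w | forall i, (i <= n)%N -> X i w = x i]
         * (P (x n) (x n.+1))%:E)%E].

(* inf {t >= 0 : X_t \in B}, equal to +oo if B is never visited. *)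
Definition hit (B : set S) (w : Omega) : \bar R :=
  ereal_inf [set (t%:R)%:E | t in [set t : nat | B (X t w)]].

(* In what follows [Pr s] is the law of the chain started at s. *)
Variable Pr : S -> probability Omega R.

Definition exp_hit (B : set S) (s : S) : \bar R :=
  (\int[Pr s]_w hit B w)%E.

Definition recurrent (s : S) : Prop :=
  Pr s [set w | exists2 t : nat, (0 < t)%N & X t w = s] = 1%E.

Definition accessible (P : S -> S -> R) (x y : S) : Prop :=
  exists n : nat, 0 < kernel_pow P n x y.

Definition recurrent_class (P : S -> S -> R) (C : set S) : Prop :=
  exists2 x, recurrent x &
    C = [set y | accessible P x y /\ accessible P y x].

Definition Chit (SR : set S) : \bar R :=
  \big[maxe/-oo%E]_(s : S) exp_hit SR s.

(* Here 0 * +oo = 0: states of stationary mass 0 do not contribute. *)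
Definition Ctar (d : S -> R) (s : S) : \bar R :=
  (\sum_(s' : S) (d s')%:E * exp_hit [set s'] s)%E.

End Trajectories.
End Chain.

(* Main.v *)
(* Let h_y(x) be the expected hitting time of y from x, and g(x) that of the
   recurrent class. Then d(y) h_y solves the Poisson equation
   (I - P)(d(y) h_y) = d(y) - 1_y, so the sum of d(y) - P^i(s, y) over
   1 <= i <= t telescopes to at most (P (d(y) h_y))(s). Total variation is the
   sum over y of the positive parts of d(y) minus the Cesaro average, hence is
   at most (P f)(s) / t with f = sum_y d(y) h_y. Finally f - g is harmonic, so
   the maximum principle gives f <= g + f(o) for any recurrent o, and
   f(o) = Ctar.
   In the proof h_y and g are solutions of Dirichlet problems, and the only
   probabilistic input is that such solutions are lower bounds for the expected
   hitting times. *)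

Require Import Defs.
From HB Require Import structures.
From mathcomp Require Import all_boot all_order all_algebra.
From mathcomp Require Import all_classical all_reals all_analysis.
From mathcomp Require Import measurable_realfun lra ring zify.

Set Implicit Arguments.
Unset Strict Implicit.
Unset Printing Implicit Defensive.

Import Order.TTheory GRing.Theory Num.Theory.
Import HBNNSimple.

Local Open Scope classical_set_scope.
Local Open Scope ring_scope.

(** * Stochastic kernels and the Dirichlet problem *)

Definition stochastic (R : realType) (S : finType) (P : S -> S -> R) : Prop :=
  forall x, is_dist (P x).

Lemma induced_kernel_stochastic (R : realType) (S A : finType) (M : mdp R S A)
    (p : policy R S A) : stochastic (induced_kernel M p).
Proof.
move=> x; split=> [y|].
  apply: sumr_ge0 => a _; apply: mulr_ge0; first exact: (trans_dist M x a).1.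
  exact: (pol_dist p x).1.
rewrite /induced_kernel exchange_big /=.
under eq_bigr => a _ do rewrite -mulr_suml (trans_dist M x a).2 mul1r.
exact: (pol_dist p x).2.
Qed.

Section KernelPowers.
Variables (R : realType) (S : finType) (P : S -> S -> R).

Lemma kernel_pow0 x y : kernel_pow P 0 x y = (x == y)%:R.
Proof. by rewrite /kernel_pow expr0 mxE (inj_eq enum_rank_inj). Qed.

Lemma sum_enum_val (f : S -> R) : \sum_(i < #|S|) f (enum_val i) = \sum_x f x.
Proof. by rewrite [RHS](reindex _ (onW_bij _ (enum_val_bij S))). Qed.

Lemma kernel_powS n x y :
  kernel_pow P n.+1 x y = \sum_z P x z * kernel_pow P n z y.
Proof.
rewrite /kernel_pow exprS mxE -sum_enum_val; apply: eq_bigr => i _.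
by rewrite mxE enum_rankK enum_valK.
Qed.

Lemma kernel_powSr n x y :
  kernel_pow P n.+1 x y = \sum_z kernel_pow P n x z * P z y.
Proof.
rewrite /kernel_pow exprSr mxE -sum_enum_val; apply: eq_bigr => i _.
by rewrite mxE enum_rankK enum_valK.
Qed.

Lemma kernel_powD m n x y :
  kernel_pow P (m + n) x y = \sum_z kernel_pow P m x z * kernel_pow P n z y.
Proof.
rewrite /kernel_pow exprD mxE -sum_enum_val; apply: eq_bigr => i _.
by rewrite !enum_valK.
Qed.

Hypothesis Pst : stochastic P.

Lemma kernel_pow_ge0 n x y : 0 <= kernel_pow P n x y.
Proof.
elim: n x => [|n IH] x; first by rewrite kernel_pow0 ler0n.
by rewrite kernel_powS; apply: sumr_ge0 => z _; rewrite mulr_ge0 ?(Pst x).1.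
Qed.

Lemma sum_kernel_pow n x : \sum_y kernel_pow P n x y = 1.
Proof.
elim: n x => [|n IH] x.
  rewrite (bigD1 x) //= kernel_pow0 eqxx big1 ?addr0 // => y yx.
  by rewrite kernel_pow0 eq_sym (negbTE yx).
under eq_bigr do rewrite kernel_powS.
rewrite exchange_big /=; under eq_bigr do rewrite -mulr_sumr IH mulr1.
exact: (Pst x).2.
Qed.

Lemma accessible_refl x : accessible P x x.
Proof. by exists 0; rewrite kernel_pow0 eqxx. Qed.

Lemma accessible1 x y : 0 < P x y -> accessible P x y.
Proof.
move=> Pxy; exists 1; rewrite kernel_powS (bigD1 y) //= kernel_pow0 eqxx mulr1.
by rewrite ltr_wpDr // sumr_ge0 // => z _; rewrite kernel_pow0 mulr_ge0 ?ler0n ?(Pst x).1.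
Qed.

Lemma accessible_trans y x z :
  accessible P x y -> accessible P y z -> accessible P x z.
Proof.
move=> [m xy] [n yz]; exists (m + n); rewrite kernel_powD (bigD1 y) //=.
rewrite ltr_wpDr ?mulr_gt0 // sumr_ge0 // => w _.
by rewrite mulr_ge0 ?kernel_pow_ge0.
Qed.

Lemma average_le (p f : S -> R) (c : R) : is_dist p ->
  (forall y, 0 < p y -> f y <= c) -> \sum_y p y * f y <= c.
Proof.
move=> [p0 p1] fc; rewrite -[leRHS]mul1r -p1 mulr_suml; apply: ler_sum => y _.
have := p0 y; rewrite le_eqVlt => /orP[/eqP <-|py]; first by rewrite !mul0r.
by rewrite ler_pM2l // fc.
Qed.

Lemma average_lt (p f : S -> R) (c : R) y : is_dist p ->
  (forall y, f y <= c) -> 0 < p y -> f y < c -> \sum_z p z * f z < c.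
Proof.
move=> [p0 p1] fc py fy; rewrite -[ltRHS]mul1r -p1 mulr_suml.
rewrite (bigD1 y) //= [ltRHS](bigD1 y) //= ltr_leD //; first by rewrite ltr_pM2l.
by apply: ler_sum => z _; rewrite ler_wpM2l.
Qed.

(** At a maximizer off [B] the value is at most the average over the successors, so every successor
    is again a maximizer. Following a path of positive probability carries the maximum into [B]. *)
Lemma maximum_principle (B : set S) (u : S -> R) (x0 : S) :
  (forall x, exists2 b, B b & accessible P x b) ->
  (forall x, ~ B x -> u x <= \sum_y P x y * u y) ->
  exists2 b, B b & forall x, u x <= u b.
Proof.
move=> accB sub_u.
have [z _ uz] := @Order.TotalTheory.arg_maxP _ _ _ x0 xpredT u isT.
have {}uz x : u x <= u z by exact: uz.
have [b Bb [n zb]] := accB z.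
elim: n z uz zb => [|n IH] z uz.
  rewrite kernel_pow0; case: eqP => [zb _|]; last by rewrite ltxx.
  by exists b => //; rewrite -zb.
rewrite kernel_powS => zb.
have [Bz|nBz] := pselect (B z); first by exists z.
have [w Pzw wb] : exists2 w, 0 < P z w & 0 < kernel_pow P n w b.
  apply: contrapT => no; suff /eqP : \sum_w P z w * kernel_pow P n w b = 0.
    by rewrite gt_eqF.
  apply: big1 => w _; have := (Pst z).1 w.
  rewrite le_eqVlt => /orP[/eqP <-|Pzw]; first by rewrite mul0r.
  have := kernel_pow_ge0 n w b.
  rewrite le_eqVlt => /orP[/eqP <-|wb]; first by rewrite mulr0.
  by case: no; exists w.
apply: (IH w) => // x; apply: (le_trans (uz x)); rewrite leNgt.
apply/negP => uw; have := sub_u z nBz; apply/negP; rewrite -ltNge.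
exact: (average_lt (Pst z) uz Pzw uw).
Qed.

(* Uniqueness from the maximum principle makes the linear system invertible. *)
Lemma dirichlet_problem (B : set S) :
  (forall x, exists2 b, B b & accessible P x b) ->
  exists v : S -> R, [/\ forall x, 0 <= v x, forall x, B x -> v x = 0 &
    forall x, ~ B x -> v x = 1 + \sum_y P x y * v y].
Proof.
move=> accB.
(* The Dirichlet problem asks that [L v] be the indicator of the complement of [B]. [A] is the
   matrix of [L] acting on row vectors, hence the transposed indices. *)
pose L (u : S -> R) x := u x - (x \notin B)%:R * \sum_y P x y * u y.
pose A : 'M[R]_#|S| := \matrix_(i, j)
  ((i == j)%:R - (enum_val j \notin B)%:R * P (enum_val j) (enum_val i)).
have mulA (r : 'rV[R]_#|S|) j :
    (r *m A) 0 j = L (fun x => r 0 (enum_rank x)) (enum_val j).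
  rewrite mxE /L enum_valK.
  under eq_bigr do rewrite mxE mulrBr.
  rewrite sumrB (bigD1 j) //= eqxx mulr1 big1 ?addr0; last first.
    by move=> i ij; rewrite (negbTE ij) mulr0.
  congr (_ - _); rewrite mulr_sumr -sum_enum_val; apply: eq_bigr => i _.
  by rewrite enum_valK mulrCA mulrA mulrC; ring.
(* A solution of the homogeneous system is harmonic off [B] and 0 on [B], so it is at most 0.
   Applying this to a solution and to its negative shows that the kernel of [A] is trivial. *)
have L0_le0 u x : (forall x, L u x = 0) -> u x <= 0.
    move=> Lu; have [|b Bb /(_ x) ub] := @maximum_principle B u x accB.
      move=> z nBz; have := Lu z; rewrite /L memNset // mul1r => /eqP.
      by rewrite subr_eq0 => /eqP ->.
    by rewrite (le_trans ub) //; have := Lu b; rewrite /L mem_set // mul0r subr0 => ->.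
  have uA : A \in unitmx.
    rewrite -row_free_unit; apply: inj_row_free => r rA0.
    have Lr x : L (fun x => r 0 (enum_rank x)) x = 0.
      by rewrite -(enum_rankK x) -mulA rA0 mxE.
    have LrN x : L (fun x => - r 0 (enum_rank x)) x = 0.
      have := Lr x; rewrite /L => Lx; under eq_bigr do rewrite mulrN.
      by rewrite sumrN mulrN -opprD Lx oppr0.
    apply/rowP => j; rewrite mxE -(enum_valK j); apply/eqP.
    rewrite eq_le (L0_le0 _ _ Lr) /=.
    by have := L0_le0 _ (enum_val j) LrN; rewrite oppr_le0.
pose c : 'rV[R]_#|S| := \row_j (enum_val j \notin B)%:R.
pose v x := (c *m invmx A) 0 (enum_rank x).
have Lv x : L v x = (x \notin B)%:R.
  by rewrite -(enum_rankK x) -mulA mulmxKV // mxE.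
have vB x : B x -> v x = 0.
  by move=> Bx; have := Lv x; rewrite /L mem_set // mul0r subr0.
have vnB x : ~ B x -> v x = 1 + \sum_y P x y * v y.
  move=> nBx; have := Lv x; rewrite /L memNset // mul1r => /eqP.
  by rewrite subr_eq => /eqP.
exists v; split => // x.
(* Nonnegativity: [- v] is subharmonic off [B] and vanishes on [B]. *)
have [|b Bb /(_ x)] := @maximum_principle B (fun x => - v x) x accB.
  move=> z /vnB ->; rewrite [leRHS](_ : _ = - \sum_y P z y * v y).
    by rewrite lerN2 lerDr.
  by rewrite -sumrN; apply: eq_bigr => y _; rewrite mulrN.
by rewrite (vB b Bb) oppr0 oppr_le0.
Qed.

End KernelPowers.

(** * Lower bounds on expected hitting times *)

Lemma measure_finite_partition (d : measure_display) (T : measurableType d)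
    (R : realType) (mu : {measure set T -> \bar R}) (I : finType)
    (D : set T) (f : T -> I) :
  (forall i, measurable (D `&` f @^-1` [set i])) ->
  (mu D = \sum_i mu (D `&` f @^-1` [set i]))%E.
Proof.
move=> mF; transitivity (mu (\bigcup_(i in setT) (D `&` f @^-1` [set i]))).
  congr (mu _); apply/seteqP; split=> [w Dw|w [i _] []//]; by exists (f w).
rewrite measure_fin_bigcup //; [|exact: finite_finset|]; last first.
  by move=> i j _ _ [w [[_ <-] [_ <-]]].
rewrite (fsbigE (index_enum I)) ?index_enum_uniq //; last first.
  by move=> i _; rewrite mem_index_enum.
by apply: eq_bigl => i; rewrite in_setT.
Qed.

Section Markov.
Variables (R : realType) (S : finType) (disp : measure_display).
Variables (Omega : measurableType disp) (X : nat -> Omega -> S).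
Variables (P : S -> S -> R) (s : S) (Pr : probability Omega R).
Hypothesis mc : markov_chain X P s Pr.

(** The event that the hitting time of [B] exceeds [n]; the sum of its probabilities over [n] is the
    expected hitting time. *)
Definition avoid (B : set S) (n : nat) : set Omega :=
  [set w | forall i, (i <= n)%N -> ~ B (X i w)].

Lemma avoidS B n : avoid B n.+1 = avoid B n `&` [set w | ~ B (X n.+1 w)].
Proof.
apply/seteqP; split=> w /=.
  by move=> a; split=> [i le_in|]; apply: a => //; apply: leqW.
by move=> [a b] i; rewrite leq_eqVlt => /orP[/eqP->//|]; apply: a.
Qed.

Lemma measurable_X n (B : set S) : measurable (X n @^-1` B).
Proof.
have [mX _ _] := mc.
have -> : X n @^-1` B = \bigcup_(x in B) X n @^-1` [set x].
  by apply/seteqP; split=> [w Bw|w [x Bx /= ->]//]; exists (X n w).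
by apply: fin_bigcup_measurable.
Qed.

Lemma measurable_avoid B n : measurable (avoid B n).
Proof.
elim: n => [|n IH].
  rewrite (_ : avoid _ _ = X 0 @^-1` (~` B)); first exact: measurable_X.
  by apply/seteqP; split=> w /= a; [exact: a | case].
rewrite avoidS; apply: measurableI => //; exact: measurable_X n.+1 (~` B).
Qed.


Lemma measurable_avoid_at B n y : measurable (avoid B n `&` X n @^-1` [set y]).
Proof. apply: measurableI; [exact: measurable_avoid | exact: measurable_X]. Qed.

(** [markov_chain] speaks of single paths only. Both sides are therefore split over the finitely
    many paths up to time [n], and the one-step clause is applied to each path that stays off
    [B]. *)
Lemma markov_property B n y :
  (Pr (avoid B n `&` X n.+1 @^-1` [set y]) =
   \sum_z Pr (avoid B n `&` X n @^-1` [set z]) * (P z y)%:E)%E.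
Proof.
have [mX _ step] := mc.
pose path w : {ffun 'I_n.+1 -> S} := [ffun i : 'I_n.+1 => X i w].
(* [ext p] prolongs [p] by [y] from time [n.+1] on, because [markov_chain] takes paths indexed by
   all of [nat]. *)
pose ext (p : {ffun 'I_n.+1 -> S}) i : S :=
  if (i <= n)%N then p (inord i) else y.
have path_ext p : path @^-1` [set p] =
    [set w | forall i, (i <= n)%N -> X i w = ext p i].
  apply/seteqP; split=> w /=.
    by move=> <- i le_in; rewrite /ext le_in ffunE inordK.
  move=> Xp; apply/ffunP => i; rewrite ffunE Xp /ext -ltnS ltn_ord //.
  by rewrite inord_val.
have path_ext' p : path @^-1` [set p] `&` X n.+1 @^-1` [set y] =
    [set w | forall i, (i <= n.+1)%N -> X i w = ext p i].
  rewrite path_ext; apply/seteqP; split=> w /=.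
    move=> [Xp Xy] i; rewrite leq_eqVlt => /orP[/eqP ->|]; last exact: Xp.
    by rewrite /ext ltnn.
  move=> Xp; split=> [i le_in|]; first by rewrite Xp // leqW.
  by rewrite Xp // /ext ltnn.
have mpath p : measurable (path @^-1` [set p]).
  rewrite (_ : _ @^-1` _ = \bigcap_(i in [set: 'I_n.+1]) X i @^-1` [set p i]).
    by apply: fin_bigcap_measurable => // i _; exact: mX.
  apply/seteqP; split=> w /=; first by move=> <- i _ /=; rewrite ffunE.
  by move=> Xp; apply/ffunP => i; rewrite ffunE; exact: Xp.
have avoid_path p (w : Omega) : path w = p -> avoid B n w <-> forall i, ~ B (p i).
  move=> <-; split=> [a i|a i le_in].
    by rewrite ffunE; apply: a; rewrite -ltnS.
  by have := a (inord i); rewrite ffunE inordK.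
have path_last p w : path w = p -> X n w = p ord_max by move=> <-; rewrite ffunE.
rewrite (measure_finite_partition Pr (f := path)); last first.
  by move=> p; apply: measurableI => //; apply: measurableI;
    [exact: measurable_avoid | exact: mX].
transitivity (\sum_z \sum_(p : {ffun 'I_n.+1 -> S})
    Pr ((avoid B n `&` X n @^-1` [set z]) `&` path @^-1` [set p])
    * (P z y)%:E)%E; last first.
  apply: eq_bigr => z _.
  rewrite (measure_finite_partition Pr (f := path)); last first.
    by move=> p; apply: measurableI => //; exact: measurable_avoid_at.
  by rewrite ge0_sume_distrl.
rewrite exchange_big /=; apply: eq_bigr => p _.
(* Once the path is given, only its endpoint contributes to the sum over [z]. *)
rewrite (bigD1 (p ord_max)) //= big1 ?adde0; last first.
  move=> z zp; rewrite [X in Pr X](_ : _ = set0) ?measure0 ?mul0e //.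
  rewrite -subset0 => w [[_ Xz] /path_last].
  by rewrite Xz => /eqP; rewrite (negbTE zp).
(* A path that meets [B] contributes 0 to both sides. *)
have [ap|nap] := pselect (forall i, ~ B (p i)); last first.
  rewrite [X in Pr X](_ : _ = set0); last first.
    by rewrite -subset0 => w [[aw _] /avoid_path [/(_ aw)]].
  rewrite [X in (_ = Pr X * _)%E](_ : _ = set0) ?measure0 ?mul0e //.
  by rewrite -subset0 => w [[aw _] /avoid_path [/(_ aw)]].
rewrite [X in Pr X](_ : _ = path @^-1` [set p] `&` X n.+1 @^-1` [set y]); last first.
  apply/seteqP; split=> w /= [].
    by move=> [_ ?] ?.
  by move=> pw ?; split=> //; split=> //; exact/(avoid_path p).
rewrite [X in (_ = Pr X * _)%E](_ : _ = path @^-1` [set p]); last first.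
  apply/seteqP; split=> w /=; first by move=> [].
  by move=> pw; split=> //; split; [exact/(avoid_path p) | exact: path_last].
rewrite path_ext' step (path_ext p) /ext leqnn ltnn.
by rewrite (_ : inord n = ord_max) //; apply/val_inj; rewrite /= inordK.
Qed.


(** For every visit time [t], the indicator at [k] is at most that of [k < t], and these add up to
    [minn n t]. *)
Lemma avoid_le_hit B n (w : Omega) :
  ((\sum_(k < n) \1_(avoid B k) w)%:E <= hit R X B w)%E.
Proof.
apply: le_ereal_inf_tmp => _ [t Bt <-]; rewrite lee_fin.
have term_le k : \1_(avoid B k) w <= (k < t)%N%:R :> R.
  rewrite indicE; case: (ltnP k t) => [_|tk]; first by case: (_ \in _) => /=; lra.
  by rewrite memNset // => /(_ t tk).
apply: (le_trans (ler_sum _ (fun k _ => term_le (k : 'I_n)))).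
rewrite -natr_sum ler_nat -(big_mkord xpredT (fun k => ((k < t)%N : nat))).
suff -> : (\sum_(0 <= k < n) (k < t) = minn n t)%N by rewrite geq_minr.
elim: n => [|n IH]; first by rewrite big_geq // min0n.
by rewrite big_nat_recr //= IH; lia.
Qed.

End Markov.

(** The integral of a nonnegative function is a supremum over the simple functions below it, so
    [hit] can be bounded below straight from this definition. *)
Lemma le_integral_nnsfun (d : measure_display) (T : measurableType d)
    (R : realType) (mu : {measure set T -> \bar R}) (h : {nnsfun T >-> R})
    (f : T -> \bar R) :
  (forall w, (h w)%:E <= f w)%E -> (\int[mu]_w (h w)%:E <= \int[mu]_w f w)%E.
Proof.
move=> hf; rewrite integral_nnsfun // patch_setT ge0_integralTE; last first.
  by move=> w; apply: le_trans (hf w); rewrite lee_fin.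
by apply: ereal_sup_ubound; exists h.
Qed.

Section ExpectedHittingTime.
Variables (R : realType) (S : finType) (disp : measure_display).
Variables (Omega : measurableType disp) (X : nat -> Omega -> S).
Variables (P : S -> S -> R) (s : S) (Pr : S -> probability Omega R).
Hypotheses (Pst : stochastic P) (mc : markov_chain X P s (Pr s)).

(** The tail-sum formula, truncated at [n]. The case [n = 0] yields nonnegativity of the
    expectation. *)
Lemma sum_avoid_le_exp_hit B n :
  (\sum_(k < n) Pr s (avoid X B k) <= exp_hit X Pr B s)%E.
Proof.
have mav k := measurable_avoid mc B k.
pose h := sum_nnsfun (fun k => indic_nnsfun R (mav k)) n.
have hE w : h w = \sum_(k < n) \1_(avoid X B k) w.
  by rewrite sum_nnsfunE.
apply: le_trans (le_integral_nnsfun (h := h) _ _); last first.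
  by move=> w; rewrite hE; exact: avoid_le_hit.
rewrite (eq_integral (fun w => \sum_(k < n) (\1_(avoid X B k) w)%:E)%E); last first.
  by move=> w _; rewrite hE sumEFin.
rewrite ge0_integral_sum //.
  by apply: lee_sum => k _; rewrite integral_indic // setIT.
by move=> k; apply/measurable_EFinP; apply: measurable_indic.
Qed.

(** Iterating the inequality along the chain killed on [B] bounds [u s] by a truncated tail sum plus
    a remainder carried by the paths still avoiding [B]. If the expectation is finite, the tails are
    decreasing and summable, so the remainder tends to 0. *)
Lemma exp_hit_ge_subsolution (B : set S) (u : S -> R) :
  (forall x, B x -> u x <= 0) ->
  (forall x, ~ B x -> u x <= 1 + \sum_y P x y * u y) ->
  ((u s)%:E <= exp_hit X Pr B s)%E.
Proof.
move=> uB unB.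
have [_ X0 _] := mc.
have exp_ge0 : (0 <= exp_hit X Pr B s)%E.
  by have := sum_avoid_le_exp_hit B 0; rewrite big_ord0.
have [Bs|nBs] := pselect (B s).
  by apply: le_trans exp_ge0; rewrite lee_fin uB.
(* [a k] is the tail probability; [b k] is the law of the killed chain at time [k], with total mass
   [a k]. *)
pose a k := fine (Pr s (avoid X B k)).
pose b k y := fine (Pr s (avoid X B k `&` X k @^-1` [set y])).
have mav k := measurable_avoid mc B k.
have mat k j y : measurable (avoid X B k `&` X j @^-1` [set y]).
  by apply: measurableI => //; exact: (measurable_X mc).
have aE k : Pr s (avoid X B k) = (a k)%:E by rewrite fineK // fin_num_measure.
have bE k y : Pr s (avoid X B k `&` X k @^-1` [set y]) = (b k y)%:E.
  by rewrite fineK // fin_num_measure.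
have a_ge0 k : 0 <= a k by rewrite fine_ge0.
have b_ge0 k y : 0 <= b k y by rewrite fine_ge0.
have ab k : a k = \sum_y b k y.
  apply: EFin_inj; rewrite -aE (measure_finite_partition (Pr s) (f := X k)) //.
  by rewrite -sumEFin; apply: eq_bigr => y _; exact: bE.
have a_decr k : a k.+1 <= a k.
  by rewrite -lee_fin -!aE le_measure ?inE // avoidS => w [].
have bB k y : B y -> b k y = 0.
  move=> By; rewrite /b [X in Pr s X](_ : _ = set0) ?measure0 //.
  by rewrite -subset0 => w [/(_ k (leqnn k)) nB /= Xy]; rewrite Xy in nB.
have bnB k y : ~ B y -> b k.+1 y = \sum_z b k z * P z y.
  move=> nBy; apply: EFin_inj; rewrite -bE -sumEFin.
  have -> : avoid X B k.+1 `&` X k.+1 @^-1` [set y] =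
      avoid X B k `&` X k.+1 @^-1` [set y].
    rewrite avoidS; apply/seteqP; split=> w /=; first by move=> [[]].
    by move=> [? Xy]; rewrite Xy.
  by rewrite (markov_property mc); apply: eq_bigr => z _; rewrite bE.
have b0 : \sum_y b 0 y * u y = u s.
  have b0s : b 0 s = 1.
    rewrite /b; have -> : avoid X B 0 `&` X 0 @^-1` [set s] = X 0 @^-1` [set s].
      apply/seteqP; split=> w /=; first by case.
      by move=> Xs; split=> // -[|//] _; rewrite Xs.
    by rewrite X0.
  (* The total mass [a 0] is at most 1, and [s] already carries mass 1. *)
  have b0y y : y != s -> b 0 y = 0.
    move=> ys; apply/eqP; rewrite eq_le b_ge0 andbT -(lerD2l (b 0 s)) addr0 b0s.
    apply: (@le_trans _ _ (a 0)).
      rewrite ab (bigD1 s) //= (bigD1 y) //= b0s lerD2l lerDl.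
      exact: sumr_ge0.
    by rewrite -lee_fin -aE probability_le1.
  by rewrite (bigD1 s) //= b0s mul1r big1 ?addr0 // => y /b0y ->; rewrite mul0r.
(* Each step releases the mass [a n] and pushes [b n] through [P]. The part landing in [B] may be
   dropped because [u] is at most 0 there. *)
have inv n : u s <= \sum_(k < n) a k + \sum_y b n y * u y.
  elim: n => [|n IH]; first by rewrite big_ord0 add0r b0.
  apply: (le_trans IH); rewrite big_ord_recr /= -addrA lerD2l.
  apply: (@le_trans _ _ (\sum_y b n y * (1 + \sum_z P y z * u z))).
    apply: ler_sum => y _; have [By|nBy] := pselect (B y).
      by rewrite bB // !mul0r.
    by rewrite ler_wpM2l // unB.
  rewrite [leLHS](eq_bigr (fun y => b n y + \sum_z b n y * P y z * u z)); last first.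
    move=> y _; rewrite mulrDr mulr1 mulr_sumr; congr (_ + _).
    by apply: eq_bigr => z _; rewrite mulrA.
  rewrite big_split /= -ab lerD2l exchange_big /=; apply: ler_sum => z _.
  rewrite -mulr_suml; have [Bz|nBz] := pselect (B z); last by rewrite bnB.
  rewrite bB // mul0r mulr_ge0_le0 ?uB // sumr_ge0 // => y _.
  by rewrite mulr_ge0 // (Pst y).1.
pose K := \sum_y `|u y|.
have K_ge0 : 0 <= K by exact: sumr_ge0.
have buK n : \sum_y b n y * u y <= K * a n.
  rewrite ab mulr_sumr; apply: ler_sum => y _; rewrite mulrC ler_wpM2r //.
  rewrite (le_trans (ler_norm _)) // /K (bigD1 y) //= lerDl sumr_ge0 //.
(* The first [n] tails are all at least [a n]; this gives the decay of [a n] when their sum is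
   bounded. *)
have na n : n%:R * a n <= \sum_(k < n) a k.
  elim: n => [|n IH]; first by rewrite big_ord0 mul0r.
  rewrite big_ord_recr /= -natr1 mulrDl mul1r lerD //.
  by apply: le_trans IH; rewrite ler_wpM2l.
case E : (exp_hit X Pr B s) exp_ge0 => [w| |] // w_ge0; last by rewrite leey.
rewrite lee_fin in w_ge0 *.
have aw n : \sum_(k < n) a k <= w.
  rewrite -lee_fin -E -sumEFin; apply: le_trans (sum_avoid_le_exp_hit B n).
  by apply: lee_sum => k _; rewrite aE.
rewrite leNgt; apply/negP => wu.
have e_gt0 : 0 < u s - w by rewrite subr_gt0.
(* This makes [n * (u s - w)] exceed [K * w], while [inv], [buK] and [na] bound it by
   [n * (K * a n)], hence by [K * w]. *)
pose n := Num.bound (K * w / (u s - w)).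
have := archi_boundP (divr_ge0 (mulr_ge0 K_ge0 w_ge0) (ltW e_gt0)).
rewrite -/n ltr_pdivrMr // ltNge => /negP; apply.
apply: (@le_trans _ _ (n%:R * (K * a n))).
  rewrite ler_wpM2l // lerBlDl.
  by apply: (le_trans (inv n)); rewrite lerD.
by rewrite mulrCA ler_wpM2l // (le_trans (na n)).
Qed.

End ExpectedHittingTime.

(** * Stationary distributions and the Poisson equation *)

Section StationaryDistribution.
Variables (R : realType) (S : finType) (P : S -> S -> R) (d : S -> R).
Hypothesis hd : stationary P d.

Lemma stationary_average (f : S -> R) :
  \sum_x d x * \sum_y P x y * f y = \sum_y d y * f y.
Proof.
under eq_bigr do rewrite mulr_sumr.
rewrite exchange_big /=; apply: eq_bigr => y _.
by rewrite -hd.2 mulr_suml; apply: eq_bigr => x _; rewrite mulrA.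
Qed.

(* Pairing the Poisson equation with d identifies its source at y (Kac). *)
Lemma poisson_equation (y : S) (h : S -> R) : h y = 0 ->
  (forall x, x <> y -> h x = 1 + \sum_z P x z * h z) ->
  forall x, d y * (h x - \sum_z P x z * h z) = d y - (x == y)%:R.
Proof.
move=> hy hx x; pose q := h y - \sum_z P y z * h z.
have kac : \sum_x d x * (h x - \sum_z P x z * h z) = 0.
  by under eq_bigr do rewrite mulrBr; rewrite sumrB stationary_average subrr.
have [->|/eqP xy] := eqVneq x y; last first.
  by rewrite subr0 [in h x]hx // addrK mulr1.
(* Off [y] the difference is 1, so [kac] reads [d y * q + (1 - d y) = 0]. *)
have := kac; rewrite (bigD1 y) //= -/q => kq.
have := hd.1.2; rewrite (bigD1 y) //=.
rewrite (eq_bigr (fun x => d x)) in kq; last first.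
  by move=> z /eqP zy; rewrite [in h z]hx // addrK mulr1.
by move=> d1; lra.
Qed.

(** The function [g - P g] is the indicator of the complement of [C], and stationarity makes its
    mean under [d] equal to 0. *)
Lemma stationary_off_closed (C : set S) (g : S -> R) :
  (forall x, C x -> g x = 0) ->
  (forall x, ~ C x -> g x = 1 + \sum_y P x y * g y) ->
  (forall x, C x -> \sum_y P x y * g y = 0) ->
  forall x, ~ C x -> d x = 0.
Proof.
move=> gC gnC PgC.
have : \sum_x d x * (g x - \sum_y P x y * g y) = 0.
  by under eq_bigr do rewrite mulrBr; rewrite sumrB stationary_average subrr.
move/psumr_eq0P => d0 x nCx.
have := d0 _ x isT; rewrite [in g x]gnC // addrK mulr1; apply => z _.
have [Cz|nCz] := pselect (C z); first by rewrite gC // PgC // subrr mulr0.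
by rewrite [in g z]gnC // addrK mulr1 hd.1.1.
Qed.

(** Averaging the Poisson equation against [kernel_pow P i s] gives [d y - kernel_pow P i s y] as a
    difference of consecutive averages of [h]. The sum starts at [i = 1], so the first average left
    over is that of [h] under [P s]. *)
Lemma cesaro_poisson (y : S) (h : S -> R) (s : S) (t : nat) :
  stochastic P ->
  (forall x, d y * (h x - \sum_z P x z * h z) = d y - (x == y)%:R) ->
  \sum_(1 <= i < t.+1) (d y - kernel_pow P i s y) =
  d y * (\sum_z P s z * h z - \sum_z kernel_pow P t.+1 s z * h z).
Proof.
move=> Pst poisson.
have kp1 z : kernel_pow P 1 s z = P s z.
  rewrite kernel_powS (bigD1 z) //= kernel_pow0 eqxx mulr1 big1 ?addr0 // => w wz.
  by rewrite kernel_pow0 (negbTE wz) mulr0.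
elim: t => [|t IH].
  by rewrite big_geq //; under [in RHS]eq_bigr do rewrite -kp1; rewrite subrr mulr0.
rewrite big_nat_recr //= IH.
suff -> : d y - kernel_pow P t.+1 s y =
    d y * (\sum_z kernel_pow P t.+1 s z * h z - \sum_z kernel_pow P t.+2 s z * h z).
  by ring.
transitivity (\sum_x kernel_pow P t.+1 s x * (d y - (x == y)%:R)).
  under eq_bigr do rewrite mulrBr.
  rewrite sumrB -mulr_suml sum_kernel_pow // mul1r; congr (_ - _).
  rewrite (bigD1 y) //= eqxx mulr1 big1 ?addr0 // => x xy.
  by rewrite (negbTE xy) mulr0.
under eq_bigr do rewrite -poisson mulrCA mulrBr.
rewrite -mulr_sumr sumrB; congr (_ * (_ - _)).
under eq_bigr do rewrite mulr_sumr.
rewrite exchange_big /=; apply: eq_bigr => z _.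
by rewrite kernel_powSr mulr_suml; apply: eq_bigr => x _; rewrite mulrA.
Qed.

End StationaryDistribution.

(** Since [p - q] has total 0, the total variation distance is the sum of the positive parts of
    [q - p]; a one-sided bound therefore suffices. *)
Lemma tv_le_sum (R : realType) (S : finType) (p q f : S -> R) :
  is_dist p -> is_dist q -> (forall x, 0 <= f x) ->
  (forall x, q x - p x <= f x) -> tv p q <= \sum_x f x.
Proof.
move=> [_ p1] [_ q1] f0 qpf; rewrite /tv.
suff -> : 2^-1 * \sum_x `|p x - q x| = \sum_x Num.max (q x - p x) 0.
  by apply: ler_sum => x _; rewrite ge_max qpf f0.
have -> : \sum_x `|p x - q x| =
    \sum_x (2 * Num.max (q x - p x) 0 + (p x - q x)).
  apply: eq_bigr => x _; case: (lerP (q x) (p x)) => qp.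
    by rewrite max_r ?subr_le0 //; ring.
  by rewrite max_l ?subr_ge0 ?(ltW qp) //; ring.
by rewrite big_split /= sumrB p1 q1 subrr addr0 -mulr_sumr mulKf.
Qed.

(** * Total variation bound in terms of Dirichlet solutions *)

Section SingleClass.
Variables (R : realType) (S : finType) (P : S -> S -> R) (d : S -> R).
Variables (o : S) (C : set S).
Hypotheses (Pst : stochastic P) (hd : stationary P d).
Hypothesis acc_o : forall x, accessible P x o.
Hypothesis CE : forall x, C x <-> accessible P o x.

Lemma closed_class x y : C x -> 0 < P x y -> C y.
Proof.
by move=> /CE ox Pxy; apply/CE; apply: (accessible_trans Pst ox (accessible1 Pst Pxy)).
Qed.

Lemma average_closed_class (g : S -> R) : (forall x, C x -> g x = 0) ->
  forall x, C x -> \sum_y P x y * g y = 0.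
Proof.
move=> gC x Cx; apply: big1 => y _.
have := (Pst x).1 y; rewrite le_eqVlt => /orP[/eqP <-|Pxy]; first by rewrite mul0r.
by rewrite gC ?mulr0 //; exact: closed_class Pxy.
Qed.

(* [f - g] is harmonic for [f x = \sum_y d y * h y x], hence maximal at [o]. *)
Lemma target_time_le (g : S -> R) (h : S -> S -> R) :
  (forall x, C x -> g x = 0) ->
  (forall x, ~ C x -> g x = 1 + \sum_y P x y * g y) ->
  (forall y, C y -> h y y = 0) ->
  (forall y, C y -> forall x, x <> y -> h y x = 1 + \sum_z P x z * h y z) ->
  forall x, \sum_y d y * h y x <= g x + \sum_y d y * h y o.
Proof.
move=> gC gnC hy hny x.
pose f x := \sum_y d y * h y x.
have d0 := stationary_off_closed hd gC gnC (average_closed_class gC).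
have Pf z : \sum_w P z w * f w = \sum_y d y * \sum_w P z w * h y w.
  under eq_bigr do rewrite mulr_sumr.
  rewrite exchange_big /=; apply: eq_bigr => y _; rewrite mulr_sumr.
  by apply: eq_bigr => w _; rewrite mulrCA.
(* The Poisson equations are summed over [y]; the total mass of [d] is 1, and targets off [C] have
   mass 0. The result is the same source term as for [g]. *)
have poisson_f z : f z - \sum_w P z w * f w = (z \notin C)%:R.
  rewrite Pf -sumrB (eq_bigr (fun y => d y - (y \in C)%:R * (z == y)%:R)); last first.
    move=> y _; have [Cy|nCy] := pselect (C y).
      by rewrite mem_set // mul1r -mulrBr (poisson_equation hd (hy y Cy) (hny y Cy)).
    by rewrite memNset // d0 // !mul0r.
  rewrite sumrB hd.1.2 (bigD1 z) //= eqxx mulr1 big1 ?addr0; last first.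
    by move=> y yz; rewrite eq_sym (negbTE yz) mulr0.
  by case: (z \in C); rewrite ?subrr ?subr0.
have harmonic z : f z - g z = \sum_w P z w * (f w - g w).
  under eq_bigr do rewrite mulrBr.
  rewrite sumrB; have /eqP := poisson_f z; rewrite subr_eq => /eqP ->.
  have [Cz|nCz] := pselect (C z).
    by rewrite mem_set //= gC // (average_closed_class gC) // add0r !subr0.
  by rewrite memNset //= gnC //; ring.
(* The singleton of [o] serves as boundary, being accessible from everywhere; there [g] vanishes. *)
have [||_ /= ->] := @maximum_principle _ _ P Pst [set o] (fun x => f x - g x) x.
- by move=> z; exists o.
- by move=> z _; rewrite -harmonic.
move/(_ x); rewrite (gC o); last by apply/CE; exact: accessible_refl.
by rewrite subr0 lerBlDl.
Qed.

Lemma tv_cesaro_le (h : S -> S -> R) (s : S) (t : nat) :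
  (forall y, ~ C y -> d y = 0) ->
  (forall y x, 0 <= h y x) ->
  (forall y, C y -> h y y = 0) ->
  (forall y, C y -> forall x, x <> y -> h y x = 1 + \sum_z P x z * h y z) ->
  (0 < t)%N ->
  tv (fun y => t%:R^-1 * \sum_(1 <= i < t.+1) kernel_pow P i s y) d <=
  t%:R^-1 * \sum_z P s z * \sum_y d y * h y z.
Proof.
move=> d0 h0 hy hny t_gt0.
have t_neq0 : t%:R != 0 :> R by rewrite pnatr_eq0 -lt0n.
have f_ge0 y : 0 <= d y * \sum_z P s z * h y z.
  rewrite mulr_ge0 ?hd.1.1 // sumr_ge0 // => z _.
  by rewrite mulr_ge0 ?h0 // (Pst s).1.
apply: (@le_trans _ _ (\sum_y t%:R^-1 * (d y * \sum_z P s z * h y z))).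
  apply: tv_le_sum => [|||y].
  - split=> [y|].
      rewrite mulr_ge0 ?invr_ge0 // sumr_ge0 // => i _.
      exact: kernel_pow_ge0.
    rewrite -mulr_sumr exchange_big /=.
    under eq_bigr do rewrite sum_kernel_pow //.
    by rewrite sumr_const_nat subSS subn0 mulVf.
  - exact: hd.1.
  - by move=> y; rewrite mulr_ge0 ?invr_ge0.
  have [Cy|nCy] := pselect (C y); last first.
    rewrite d0 // sub0r mul0r mulr0 oppr_le0 mulr_ge0 ?invr_ge0 // sumr_ge0 // => i _.
    exact: kernel_pow_ge0.
  have -> : d y - t%:R^-1 * \sum_(1 <= i < t.+1) kernel_pow P i s y =
      t%:R^-1 * \sum_(1 <= i < t.+1) (d y - kernel_pow P i s y).
    rewrite sumrB sumr_const_nat subSS subn0 mulrBr -[d y *+ t]mulr_natl.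
    by rewrite mulKf.
  rewrite ler_wpM2l ?invr_ge0 //.
  rewrite (cesaro_poisson s t Pst (poisson_equation hd (hy y Cy) (hny y Cy))).
  rewrite ler_wpM2l ?hd.1.1 // gerDl oppr_le0 sumr_ge0 // => z _.
  by rewrite mulr_ge0 ?h0 // kernel_pow_ge0.
rewrite -mulr_sumr ler_wpM2l ?invr_ge0 //.
under [leRHS]eq_bigr do rewrite mulr_sumr.
rewrite exchange_big /=; apply: ler_sum => y _; rewrite mulr_sumr.
by apply: ler_sum => z _; rewrite mulrCA.
Qed.

End SingleClass.

(** * From Dirichlet solutions to expected hitting times *)

Section ClassHitting.
Variables (R : realType) (S : finType) (disp : measure_display).
Variables (Omega : measurableType disp) (X : nat -> Omega -> S).
Variables (P : S -> S -> R) (Pr : S -> probability Omega R).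
Hypotheses (Pst : stochastic P) (mc : forall s, markov_chain X P s (Pr s)).

Lemma exp_hit_ge0 B s : (0 <= exp_hit X Pr B s)%E.
Proof. by have := sum_avoid_le_exp_hit (mc s) B 0; rewrite big_ord0. Qed.

(* Constant multiples of the indicator of the states accessible from s are
   subsolutions. *)
Lemma exp_hit_inaccessible B s :
  (forall b, B b -> ~ accessible P s b) -> exp_hit X Pr B s = +oo%E.
Proof.
move=> nacc; apply/eqyP => c c_gt0.
pose D := [set y | accessible P s y].
have := @exp_hit_ge_subsolution _ _ _ _ X P s Pr Pst (mc s) B
  (fun x => c * (x \in D)%:R).
rewrite mem_set ?mulr1; last exact: accessible_refl.
apply=> [x /nacc nDx|x _]; first by rewrite memNset // mulr0.
have PD_ge0 y : 0 <= P x y * (c * (y \in D)%:R).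
  by rewrite !mulr_ge0 ?ler0n ?(ltW c_gt0) // (Pst x).1.
have [Dx|nDx] := pselect (D x); last first.
  by rewrite [x \in D]memNset // mulr0 addr_ge0 // sumr_ge0.
rewrite [x \in D]mem_set // mulr1 -[leLHS]add0r lerD //.
(* [D] is closed under [P], so on [D] the average is again [c]. *)
rewrite -[leLHS]mul1r -[X in X * _](Pst x).2 mulr_suml; apply: ler_sum => y _.
have := (Pst x).1 y; rewrite le_eqVlt => /orP[/eqP <-|Pxy]; first by rewrite !mul0r.
by rewrite mem_set ?mulr1 //; exact: (accessible_trans Pst Dx (accessible1 Pst Pxy)).
Qed.

Lemma Ctar_ge0 (d : S -> R) s : (forall y, 0 <= d y) -> (0 <= Ctar X Pr d s)%E.
Proof.
move=> d0; apply: sume_ge0 => y _.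
by apply: mule_ge0; [rewrite lee_fin | exact: exp_hit_ge0].
Qed.

(** The real number [T] is built from Dirichlet solutions, so the total variation bound is stated in
    the reals and only the comparison with the expectations uses extended reals. *)
Lemma tv_cesaro_le_hit_tar (d : S -> R) (C : set S) (o : S) (t : nat) (s : S) :
  stationary P d -> recurrent_class X Pr P C -> C o ->
  (forall x, exp_hit X Pr C x != +oo%E) -> (0 < t)%N ->
  exists x (T : R), [/\ (T%:E <= exp_hit X Pr C x + Ctar X Pr d o)%E &
    tv (fun y => t%:R^-1 * \sum_(1 <= i < t.+1) kernel_pow P i s y) d
      <= t%:R^-1 * T].
Proof.
move=> hd [r _ Cr] Co hit_fin t_gt0.
have [ro or] : accessible P r o /\ accessible P o r by rewrite Cr in Co.
(* Finite expected hitting times force the class to be accessible from every state. *)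
have accC x : exists2 b, C b & accessible P x b.
  apply: contrapT => nacc; have /negP := hit_fin x; apply; apply/eqP.
  by apply: exp_hit_inaccessible => b Cb xb; apply: nacc; exists b.
have acc_o x : accessible P x o.
  have [b] := accC x; rewrite Cr => -[_ br] xb.
  exact: (accessible_trans Pst xb (accessible_trans Pst br ro)).
have CE x : C x <-> accessible P o x.
  rewrite Cr; split=> [[rx _]|ox]; first exact: (accessible_trans Pst or rx).
  by split; [exact: (accessible_trans Pst ro ox)
            | exact: (accessible_trans Pst (acc_o x) or)].
have [g [_ gC gnC]] := dirichlet_problem Pst accC.
(* For [y] in [C] the singleton of [y] is accessible from everywhere. For other [y] any nonnegative
   function will do, because [d y = 0]. *)
have /choice[h hP] y : exists h : S -> R, (forall x, 0 <= h x) /\ (C y ->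
    h y = 0 /\ forall x, x <> y -> h x = 1 + \sum_z P x z * h z).
  have [Cy|nCy] := pselect (C y); last by exists (fun=> 0).
  have [|h [h0 hy hny]] := @dirichlet_problem _ _ P Pst [set y].
    move=> x; exists y => //; apply: (accessible_trans Pst (acc_o x)).
    exact/CE.
  by exists h; split=> // _; split; [exact: hy | move=> x xy; exact: hny].
have h0 y := (hP y).1.
have hy y Cy := ((hP y).2 Cy).1.
have hny y Cy := ((hP y).2 Cy).2.
have d0 := stationary_off_closed hd gC gnC (average_closed_class Pst CE gC).
have f_le := target_time_le Pst hd acc_o CE gC gnC hy hny.
(* The maximum of [g] bounds its average under [P s]; its location [m] is the starting state
   required. *)
have [m _ gm] := @Order.TotalTheory.arg_maxP _ _ _ o xpredT g isT.
exists m, (g m + \sum_y d y * h y o); split; last first.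
  apply: (le_trans (tv_cesaro_le Pst hd s d0 h0 hy hny t_gt0)).
  rewrite ler_wpM2l ?invr_ge0 //; apply: average_le => // y _.
  by rewrite (le_trans (f_le y)) // lerD2r; exact: gm.
rewrite EFinD leeD //.
  apply: (exp_hit_ge_subsolution Pst (mc m)) => x Cx; first by rewrite gC.
  by rewrite -gnC.
rewrite -sumEFin; apply: lee_sum => y _.
have [Cy|nCy] := pselect (C y); last by rewrite d0 // mul0r mul0e.
rewrite EFinM lee_wpmul2l ?lee_fin ?hd.1.1 //.
apply: (exp_hit_ge_subsolution Pst (mc o)) => x; first by move=> ->; rewrite hy.
by move=> xy; rewrite -hny.
Qed.

End ClassHitting.

(** * Passage to the suprema over the policy class *)

Theorem lemma2 (R : realType) (S A : finType) (M : mdp R S A)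
    (Theta : Type) (pi : Theta -> policy R S A)
    (* trajectory space, with Pr theta s the law of the chain started at s *)
    (disp : measure_display) (Omega : measurableType disp)
    (X : nat -> Omega -> S) (Pr : Theta -> S -> probability Omega R)
    (hchain : forall theta s,
       markov_chain X (induced_kernel M (pi theta)) s (Pr theta s))
    (* SR theta is the one and only recurrent class *)
    (SR : Theta -> set S)
    (hSR : forall theta,
       unique (recurrent_class X (Pr theta) (induced_kernel M (pi theta))) (SR theta))
    (d : Theta -> S -> R)
    (hd : forall theta, stationary (induced_kernel M (pi theta)) (d theta))
    (* the fixed recurrent state from which the targets are hit *)
    (sref : Theta -> S) (hsref : forall theta, SR theta (sref theta)) :
  let C : \bar R :=
    (ereal_sup (range (fun theta => Chit X (Pr theta) (SR theta)))
     + ereal_sup (range (fun theta =>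
         Ctar X (Pr theta) (d theta) (sref theta))))%E in
  forall (theta : Theta) (t : nat), (1 <= t)%N ->
  forall s0 : S,
    ((tv (fun s => t%:R^-1 *
            \sum_(1 <= i < t.+1) kernel_pow (induced_kernel M (pi theta)) i s0 s)
         (d theta))%:E <= C / t%:R%:E)%E.
Proof.
move=> C theta t t_gt0 s0.
set P := induced_kernel M (pi theta).
have Pst : stochastic P := induced_kernel_stochastic M (pi theta).
have tV : (t%:R%:E^-1 = (t%:R^-1)%:E :> \bar R)%E.
  by rewrite inver pnatr_eq0 eqn0Ngt t_gt0.
pose H x := exp_hit X (Pr theta) (SR theta) x.
pose T := Ctar X (Pr theta) (d theta) (sref theta).
have T_ge0 : (0 <= T)%E by apply: (Ctar_ge0 (hchain theta)); exact: (hd theta).1.1.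
have HC x : (H x + T <= C)%E.
  apply: leeD; last by apply: ereal_sup_ubound; exists theta.
  apply: (@le_trans _ _ (Chit X (Pr theta) (SR theta))); first exact: le_bigmax.
  by apply: ereal_sup_ubound; exists theta.
(* If some expected hitting time of the class is infinite, then [C] is infinite and the bound is
   trivial. *)
have [[x /eqP Hx]|H_fin] := pselect (exists x, H x == +oo%E).
  have -> : C = +oo%E.
    apply/eqP; by rewrite -leye_eq -Hx (le_trans _ (HC x)) // leeDl.
  by rewrite tV gt0_mulye ?leey // lte_fin invr_gt0 ltr0n.
have [|x [v [vHT tv_le]]] := tv_cesaro_le_hit_tar Pst (hchain theta) s0
    (hd theta) (hSR theta).1 (hsref theta) _ t_gt0.
  by move=> x; apply/negP => Hx; apply: H_fin; exists x.
apply: (@le_trans _ _ (v%:E / t%:R%:E)%E).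
  by rewrite tV -EFinM lee_fin mulrC.
by rewrite tV lee_wpmul2r ?lee_fin ?invr_ge0 // (le_trans vHT).
Qed.
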